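(* Let $p\ge 1$ be an integer. The number of similarity classes of indecomposable triples $(V,T,U)$ with $o(T)=p$ and $n_U=n_V=2$ is the binomial coefficient $\binom{p}{4}$.
   Context: All vector spaces are finite-dimensional over $\mathbb{C}$. A triple $(V,T,U)$ consists of a vector space $V$, a nilpotent linear operator $T$ on $V$, and a subspace $U\subset V$ with $T(U)\subset U$. The order of nilpotency is $o(T)=p\ge 1$ with $T^p=0$ and $T^{p-1}\neq 0$. For an invariant subspace $W$ of $T$ put $[W]=\ker(T|_W)$ and $n_W=\dim [W]$ (in particular $n_V=\dim\ker T$). The triple $(V,T,U)$ is indecomposable if for all $T$-invariant subspaces $V',V''$ with $V=V'\oplus V''$ and $U=(U\cap V')\oplus(U\cap V'')$ one has $V'=\{0\}$ or $V''=\{0\}$. Two triples $(V,T,U)$ and $(V',T',U')$ are similar if there is an invertible linear map $f:V\to V'$ with $f(U)=U'$ and $fT=T'f$. Binomial coefficients $\binom{p}{m}$ with $m>p$ are $0$. *)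

(* Defs.v *)
From HB Require Import structures.
From mathcomp Require Import all_boot all_order all_algebra.
From mathcomp Require Import complex.
From mathcomp Require Import reals.

Set Implicit Arguments.
Unset Strict Implicit.
Unset Printing Implicit Defensive.

Import GRing.Theory.
Local Open Scope ring_scope.

Section Triples.
Variable K : fieldType.

(* Written by iteration because 'End(V) is not a ring when V = 0.  With this
   definition lfun_pow T 0 is the identity. *)
Definition lfun_pow (V : vectType K) (T : 'End(V)) (n : nat) : 'End(V) :=
  iter n (fun S => (T \o S)%VF) \1%VF.

Definition invariant_subspace (V : vectType K) (T : 'End(V))
    (W : {vspace V}) : Prop := (T @: W <= W)%VS.

Record triple := Triple {
  tspace : vectType K;
  toper : 'End(tspace);
  tsub : {vspace tspace};
  toper_nilpotent : exists n, lfun_pow toper n = 0;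
  tsub_invariant : invariant_subspace toper tsub
}.

Definition nilpotency_order (V : vectType K) (T : 'End(V)) (p : nat) : Prop :=
  [/\ (0 < p)%N, lfun_pow T p = 0 & lfun_pow T p.-1 <> 0].

Definition nker (V : vectType K) (T : 'End(V)) (W : {vspace V}) : nat :=
  \dim (W :&: lker T).

(* The zero triple satisfies this condition vacuously. *)
Definition indecomposable (t : triple) : Prop :=
  forall V1 V2 : {vspace tspace t},
    invariant_subspace (toper t) V1 ->
    invariant_subspace (toper t) V2 ->
    directv (V1 + V2) -> fullv = (V1 + V2)%VS ->
    directv ((tsub t :&: V1) + (tsub t :&: V2)) ->
    tsub t = ((tsub t :&: V1) + (tsub t :&: V2))%VS ->
    V1 = 0%VS \/ V2 = 0%VS.

Definition similar (t t' : triple) : Prop :=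
  exists f : 'Hom(tspace t, tspace t'),
    [/\ bijective f, (f @: tsub t)%VS = tsub t'
      & (f \o toper t)%VF = (toper t' \o f)%VF].

(* A similarity class is a predicate on triples.  It is not a [set triple]: the
   universe of [set] lies strictly below that of [vectType], so the type
   [set triple] is rejected and the cardinality notation of mathcomp-classical
   is unavailable here. *)
Definition similarity_classes (P : triple -> Prop) :=
  {C : triple -> Prop | exists2 t, P t & C = similar t}.

Definition number_similarity_classes (P : triple -> Prop) (n : nat) : Prop :=
  exists f : 'I_n -> similarity_classes P, bijective f.

End Triples.

(* Main.v *)
From Pilot Require Import Defs.
From mathcomp Require Import all_boot all_order all_algebra.
From mathcomp Require Import complex reals.
From mathcomp Require Import boolp zify.

(** A triple with two blocks is a chain of lattices.  Let [O] be the power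
    series ring in one variable [x] over the base field.  Two Jordan blocks in
    [V] mean [V = F / L] with [F] free of rank 2 over [O], with [T] acting as
    [x] and [L] contained in [x F]; the subspace [U] is [M / L] for a lattice
    [M] between [L] and [F], and [n_U = 2] says that [L] lies in [x M].
    The lattices of the plane, up to powers of [x], are the vertices of a tree
    in which a basis of the plane gives an infinite line.  The triple
    decomposes exactly when [F], [M], [L] lie on one such line.  Otherwise they
    are the ends of a tripod with three legs of positive length, and the
    automorphisms of the plane act transitively on tripods with given leg
    lengths.  So an indecomposable triple is determined by three leg lengths
    and two relative scalings.  Fixing [o(T) = p] leaves four parameters, whose
    inequalities are those of four increasing numbers below [p].

    Concretely, the triple has generators [f], [g] of [V], of orders [p] and
    [q], such that [T ^ i f] and [T ^ j (g + T ^ e f)] generate [U]; this is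
    the predicate [tripod].  The legs towards [F], [M] and [L] have lengths
    [e], [i - j - e] and [p - q - e], and the four increasing numbers are
    [j < i - e < q < p - e].

    That every indecomposable triple has this form is
    [tripod_of_indecomposable].  It adapts generators of [V] to [U]
    ([stacked_gen]), takes a generator [g] of the short block of [V]
    ([jordan_gen]), and compares the two; in each degenerate position of [g]
    an exchange of generators exhibits a decomposition.  All of this rests on
    Nakayama's lemma and on the fact that the submodules of a cyclic module
    form a chain.

    Conversely, [dim V], [dim U], the order of [T] on [U] and the order of [T]
    on [V / U] recover the parameters ([tripod_inj]).  The same numbers,
    computed for a direct sum of two chains, never satisfy the inequalities of
    a tripod, which gives indecomposability ([tripod_indecomposable]).
    Finally, triples with equal parameters are similar ([similar_tripods]) and
    every choice of parameters occurs ([tripod_model]). *)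

Set Implicit Arguments.
Unset Strict Implicit.
Unset Printing Implicit Defensive.

Import GRing.Theory.

Local Open Scope ring_scope.
Local Open Scope nat_scope.

(* Matrix similarity has the same short name. *)
Local Notation similar := Pilot.Defs.similar.
Local Notation "T ^^ n" := (lfun_pow T n) (at level 20, n at level 9, left associativity).

(** * Iterates of an operator and invariant subspaces *)

Section Subspaces.
Variables (K : fieldType) (V : vectType K).
Implicit Types (f : V) (W : {vspace V}).

Lemma addv_eq0 W1 W2 : (W1 + W2 == 0)%VS = (W1 == 0)%VS && (W2 == 0)%VS.
Proof. by rewrite -!subv0 subv_add. Qed.

Lemma dim_add_line f W : f \notin W -> \dim (<[f]> + W) = (\dim W).+1.
Proof.
move=> fW; rewrite dimv_disjoint_sum ?dim_vline.
  by have -> : f != 0%R by apply: contraNneq fW => ->; exact: mem0v.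
apply/eqP; rewrite -subv0; apply/subvP => v /memv_capP [/vlineP [a ->]].
rewrite rpredZeq (negPf fW) orbF => /eqP ->; by rewrite scale0r mem0v.
Qed.

End Subspaces.

Section Powers.
Variables (K : fieldType) (V : vectType K) (T : 'End(V)).
Implicit Types (v f g : V) (W : {vspace V}).

Lemma pow0E v : (T ^^ 0) v = v.
Proof. by rewrite /lfun_pow /= id_lfunE. Qed.

Lemma powSE n v : (T ^^ n.+1) v = T ((T ^^ n) v).
Proof. by rewrite /lfun_pow /= comp_lfunE. Qed.

Lemma powD m n v : (T ^^ (m + n)) v = (T ^^ m) ((T ^^ n) v).
Proof. by elim: m => [|m IH]; rewrite ?add0n ?pow0E // addSn !powSE IH. Qed.

Lemma pow1E v : (T ^^ 1) v = T v.
Proof. by rewrite powSE pow0E. Qed.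

Lemma powSr n v : (T ^^ n.+1) v = (T ^^ n) (T v).
Proof. by rewrite -addn1 powD pow1E. Qed.

Lemma powC m n v : (T ^^ m) ((T ^^ n) v) = (T ^^ n) ((T ^^ m) v).
Proof. by rewrite -!powD addnC. Qed.

Lemma pow_eq0_leq m n v : m <= n -> (T ^^ m) v = 0%R -> (T ^^ n) v = 0%R.
Proof. by move=> le_mn v0; rewrite -(subnK le_mn) powD v0 linear0. Qed.

Lemma inv_mem W v : invariant_subspace T W -> v \in W -> T v \in W.
Proof. by move=> iW vW; apply: (subvP iW); exact: memv_img. Qed.

Lemma inv_pow W n v : invariant_subspace T W -> v \in W -> (T ^^ n) v \in W.
Proof.
by move=> iW vW; elim: n => [|n IH]; rewrite ?pow0E // powSE; exact: inv_mem.
Qed.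

Lemma inv_leq W m n v : invariant_subspace T W -> m <= n ->
  (T ^^ m) v \in W -> (T ^^ n) v \in W.
Proof. by move=> iW le_mn vW; rewrite -(subnK le_mn) powD inv_pow. Qed.

Lemma inv_add W1 W2 : invariant_subspace T W1 -> invariant_subspace T W2 ->
  invariant_subspace T (W1 + W2)%VS.
Proof. by move=> i1 i2; rewrite /invariant_subspace limgD addvS. Qed.

Lemma inv_cap W1 W2 : invariant_subspace T W1 -> invariant_subspace T W2 ->
  invariant_subspace T (W1 :&: W2)%VS.
Proof.
by move=> i1 i2; apply: subv_trans (limg_cap _ _ _) _; rewrite capvS.
Qed.

Lemma inv_img n W : invariant_subspace T W -> invariant_subspace T (T ^^ n @: W)%VS.
Proof.
move=> iW; apply/subvP => _ /memv_imgP [_ /memv_imgP [v vW ->] ->].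
by rewrite -pow1E powC; apply: memv_img; rewrite pow1E inv_mem.
Qed.

(** The span of the first [n] iterates of [f]; once [T ^^ n] kills [f] this is
    the cyclic submodule generated by [f]. *)
Definition krylov n f : {vspace V} := <<mkseq (fun k => (T ^^ k) f) n>>%VS.

Lemma mem_krylov n f k : k < n -> (T ^^ k) f \in krylov n f.
Proof.
by move=> lt_kn; apply: memv_span; apply/mapP; exists k; rewrite // mem_iota.
Qed.

Lemma dim_krylov n f : \dim (krylov n f) <= n.
Proof. by apply: leq_trans (dim_span _) _; rewrite size_mkseq. Qed.

Lemma krylov_subP n f W : (forall k, k < n -> (T ^^ k) f \in W) -> (krylov n f <= W)%VS.
Proof.
move=> sub; apply/span_subvP => _ /mapP [k + ->]; rewrite mem_iota => /andP [_ lt_kn].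
exact: sub.
Qed.

Lemma krylov_sub n f W : invariant_subspace T W -> f \in W -> (krylov n f <= W)%VS.
Proof. by move=> iW fW; apply: krylov_subP => k _; exact: inv_pow. Qed.

Lemma krylov_short m n f : (T ^^ m) f = 0%R -> (T ^^ n) f = 0%R -> krylov m f = krylov n f.
Proof.
have le_krylov a b : (T ^^ b) f = 0%R -> (krylov a f <= krylov b f)%VS.
  move=> f0; apply: krylov_subP => k _; case: (ltnP k b) => [|le_bk].
    exact: mem_krylov.
  by rewrite (pow_eq0_leq le_bk f0) mem0v.
by move=> m0 n0; apply/eqP; rewrite eqEsubv !le_krylov.
Qed.

End Powers.

(** * Modules over a nilpotent operator *)

Section Nilpotent.
Variables (K : fieldType) (V : vectType K) (T : 'End(V)) (p : nat).
Hypothesis Tp0 : T ^^ p = 0%R.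
Implicit Types (v f g : V) (W : {vspace V}).
Local Notation inv := (invariant_subspace T).
Local Notation cyc := (krylov T p).

Lemma powp v : (T ^^ p) v = 0%R.
Proof. by rewrite Tp0 lfunE. Qed.

Lemma pow_ge n v : p <= n -> (T ^^ n) v = 0%R.
Proof. by move=> le_pn; apply: (pow_eq0_leq le_pn); exact: powp. Qed.

Lemma mem_cyc_pow f k : (T ^^ k) f \in cyc f.
Proof.
by case: (ltnP k p) => [|le_pk]; [exact: mem_krylov | rewrite pow_ge // mem0v].
Qed.

Lemma mem_cyc f : f \in cyc f.
Proof. by rewrite -{1}(pow0E T f) mem_cyc_pow. Qed.

Lemma cyc_inv f : inv (cyc f).
Proof.
rewrite /invariant_subspace limg_span; apply/span_subvP => _ /mapP [_ /mapP [k _ ->] ->].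
by rewrite -powSE mem_cyc_pow.
Qed.
Hint Resolve cyc_inv : core.

Lemma cyc_subE f W : inv W -> (cyc f <= W)%VS = (f \in W).
Proof.
move=> iW; apply/idP/idP => [/subvP|]; last exact: krylov_sub.
by apply; exact: mem_cyc.
Qed.

Lemma cyc2_subE f g W : inv W -> (cyc f + cyc g <= W)%VS = (f \in W) && (g \in W).
Proof. by move=> iW; rewrite subv_add !cyc_subE. Qed.

Lemma inv_cyc2 f g : inv (cyc f + cyc g)%VS.
Proof. exact: inv_add. Qed.
Hint Resolve inv_cyc2 : core.

Lemma mem_cyc2l f g : f \in (cyc f + cyc g)%VS.
Proof. by apply: (subvP (addvSl _ _)); exact: mem_cyc. Qed.

Lemma mem_cyc2r f g : g \in (cyc f + cyc g)%VS.
Proof. by apply: (subvP (addvSr _ _)); exact: mem_cyc. Qed.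

(** Nakayama's lemma: iterating the inclusion puts [W] inside
    [W' + T ^^ n @: W] for every [n], and the last term dies at [n = p]. *)
Lemma nakayama W W' : inv W' -> (W <= W' + T @: W)%VS -> (W <= W')%VS.
Proof.
move=> iW' sub; suff H n : (W <= W' + T ^^ n @: W)%VS.
  by have := H p; rewrite Tp0 lim0g addv0.
elim: n => [|n IH]; first by rewrite /lfun_pow /= lim1g addvSr.
apply: (subv_trans sub); rewrite subv_add addvSl /=.
apply: subv_trans (limgS T IH) _; rewrite limgD -limg_comp.
by rewrite addvS.
Qed.

Lemma cyc_img k f : (T ^^ k @: cyc f)%VS = cyc ((T ^^ k) f).
Proof.
apply/eqP; rewrite eqEsubv; apply/andP; split.
  rewrite limg_span; apply/span_subvP => _ /mapP [_ /mapP [i _ ->] ->].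
  by rewrite powC mem_cyc_pow.
rewrite cyc_subE; last exact: inv_img.
by apply: memv_img; exact: mem_cyc.
Qed.

Lemma cyc_imgT f : (T @: cyc f)%VS = cyc (T f).
Proof.
rewrite -pow1E -cyc_img; congr (_ @: _)%VS.
by rewrite /lfun_pow /= comp_lfun1r.
Qed.

Lemma cycS f : cyc f = (<[f]> + cyc (T f))%VS.
Proof.
apply/eqP; rewrite eqEsubv; apply/andP; split.
  apply: krylov_subP => -[|k] _; first by rewrite pow0E (subvP (addvSl _ _)) // memv_line.
  by rewrite powSr (subvP (addvSr _ _)) // mem_cyc_pow.
rewrite subv_add -memvE mem_cyc /= cyc_subE //.
by apply: inv_mem; rewrite ?mem_cyc.
Qed.

Lemma dim_img W : \dim W = (\dim (W :&: lker T) + \dim (T @: W))%N.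
Proof. by rewrite limg_ker_dim. Qed.

Lemma inv_cyc_img f v : v \in cyc f ->
  exists2 c, c \in cyc f & exists a, v = (a *: f + T c)%R.
Proof.
rewrite {1}cycS => /memv_addP [_ /vlineP [a ->] [w]].
by rewrite -cyc_imgT => /memv_imgP [c cf ->] ->; exists c; last exists a.
Qed.

(** Such an [h] is a nonzero multiple of [f] up to the radical [T @: cyc f], so
    [f] lies in [cyc h] up to the radical and Nakayama's lemma applies. *)
Lemma cyc_gen f h : h \in cyc f -> h \notin (T @: cyc f)%VS -> cyc h = cyc f.
Proof.
move=> hf hNT; apply/eqP; rewrite eqEsubv cyc_subE // hf /=.
apply: nakayama => //; rewrite cyc_subE; last first.
  by apply: inv_add => //; rewrite cyc_imgT.
have [c cf [a ha]] := inv_cyc_img hf.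
have Tc : T c \in (T @: cyc f)%VS by exact: memv_img.
have a0 : a != 0%R by apply: contraNneq hNT => a0; rewrite ha a0 scale0r add0r.
have {1}-> : f = (a^-1 *: h + - (a^-1 *: T c))%R.
  by rewrite ha scalerDr scalerA mulVf // scale1r addrK.
by apply: memv_add; [exact/memvZ/mem_cyc | rewrite memvN memvZ].
Qed.

(** Take [e] maximal such that [v] lies in [T ^^ e @: cyc f]: the remaining
    factor is then outside the radical, so that [cyc_gen] applies.  This
    replaces the factorisation of a power series as a power of the variable
    times a unit. *)
Lemma cyc_unit f v : v \in cyc f ->
  exists e h, cyc h = cyc f /\ v = (T ^^ e) h.
Proof.
move=> vf; have [->|v0] := eqVneq v 0%R.
  by exists p, f; rewrite powp.
have ex0 : exists e, v \in (T ^^ e @: cyc f)%VS.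
  by exists 0; rewrite cyc_img pow0E.
have bd e : v \in (T ^^ e @: cyc f)%VS -> e <= p.
  move=> ve; rewrite leqNgt; apply: contraNN v0 => /ltnW lt_pe.
  by move/memv_imgP: ve => [w _ ->]; rewrite pow_ge.
case: (ex_maxnP ex0 bd) => e ve max_e.
have /memv_imgP [h hf def_v] := ve.
exists e, h; split=> //.
apply: cyc_gen => //; apply/negP => /memv_imgP [w wf def_h].
suff /max_e : v \in (T ^^ e.+1 @: cyc f)%VS by rewrite ltnn.
by rewrite def_v def_h -powSr memv_img.
Qed.

Lemma cyc_submod f W : inv W -> (W <= cyc f)%VS ->
  exists i, W = cyc ((T ^^ i) f).
Proof.
move=> iW Wf; have ex0 : exists i, (T ^^ i) f \in W by exists p; rewrite powp mem0v.
case: (ex_minnP ex0) => i fi min_i.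
exists i; apply/eqP; rewrite eqEsubv cyc_subE // fi andbT; apply/subvP => v vW.
have [e [h [hf def_v]]] := cyc_unit (subvP Wf v vW).
have cv : cyc v = cyc ((T ^^ e) f) by rewrite def_v -cyc_img hf cyc_img.
have le_ie : i <= e.
  by apply: min_i; rewrite -cyc_subE // -cv cyc_subE.
by rewrite -cyc_subE // cv cyc_subE // -(subnK le_ie) powD mem_cyc_pow.
Qed.

Lemma inv_ker_eq0 W : inv W -> (W :&: lker T = 0)%VS -> W = 0%VS.
Proof.
move=> iW k0; apply/eqP; rewrite -subv0; apply: nakayama.
  by rewrite /invariant_subspace limg0 sub0v.
by rewrite add0v -(geq_leqif (dimv_leqif_sup iW)) dim_img k0 dimv0.
Qed.

(** By rank and nullity, the kernel of [T] on [W] is as large as [W] modulo its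
    radical, which by Nakayama's lemma is the number of generators. *)
Lemma cyc_of_ker1 W : inv W -> \dim (W :&: lker T) <= 1 -> exists f, W = cyc f.
Proof.
move=> iW k1; have [sub|/subvPn [f fW fNT]] := boolP (W <= T @: W)%VS.
  exists 0%R; apply/eqP; rewrite eqEsubv cyc_subE // mem0v andbT.
  by apply: nakayama => //; apply: subv_trans sub (addvSr _ _).
exists f; apply/eqP; rewrite eqEsubv cyc_subE // fW andbT.
apply: nakayama => //; apply: (@subv_trans _ _ (<[f]> + T @: W)%VS); last first.
  by rewrite addvS // -memvE mem_cyc.
rewrite -(geq_leqif (dimv_leqif_sup _)); last by rewrite subv_add -memvE fW.
by rewrite dim_add_line // dim_img; lia.
Qed.

Lemma dim_cyc_ker f : \dim (cyc f :&: lker T) <= 1.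
Proof.
have := dim_img (cyc f); rewrite {1}cycS cyc_imgT => e.
have := (dimv_add_leqif <[f]> (cyc (T f))); case=> + _.
rewrite {}e dim_vline; case: (f != 0%R) => /=; lia.
Qed.

Lemma dim_cyc f q : (T ^^ q) f = 0%R -> (forall k, k < q -> (T ^^ k) f != 0%R) ->
  \dim (cyc f) = q.
Proof.
elim: q f => [|q IH] f fq fk.
  rewrite pow0E in fq; apply/eqP; rewrite dimv_eq0 -subv0 fq cyc_subE ?mem0v //.
  by rewrite /invariant_subspace limg0 sub0v.
rewrite dim_img cyc_imgT IH; last 2 first.
- by rewrite -powSr.
- by move=> k lt_kq; rewrite -powSr fk.
suff : \dim (cyc f :&: lker T) = 1 by move->.
apply/eqP; rewrite eqn_leq dim_cyc_ker lt0n dimv_eq0.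
apply/eqP => /inv_ker_eq0 -/(_ (cyc_inv f)) cf0.
by have := fk 0 isT; rewrite pow0E -memv0 -cf0 mem_cyc.
Qed.

(** Nakayama's lemma for two generators: [f1] completes [f2] to a basis of [V]
    modulo its radical [limg T]. *)
Lemma complement_gen f2 : \dim (lker T) = 2 -> f2 \notin limg T ->
  exists f1, fullv = (cyc f1 + cyc f2)%VS.
Proof.
move=> k2 f2N; have := dim_img fullv; rewrite capfv k2 => dV.
have /subvPn [f1 _ f1N] : ~~ (fullv <= <[f2]> + limg T)%VS.
  by apply/negP => /dimvS; rewrite dim_add_line //; lia.
exists f1; apply/esym/eqP; rewrite eqEsubv subvf /=; apply: nakayama => //.
apply: (@subv_trans _ _ (<[f1]> + (<[f2]> + limg T))%VS); last first.
  by rewrite addvA addvS // addvS // -memvE mem_cyc.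
by rewrite -(geq_leqif (dimv_leqif_sup (subvf _))) !dim_add_line //; lia.
Qed.

Lemma cyc0 : cyc 0%R = 0%VS.
Proof.
apply/eqP; rewrite -subv0 cyc_subE ?mem0v //.
by rewrite /invariant_subspace limg0 sub0v.
Qed.

Lemma cycN f : cyc (- f)%R = cyc f.
Proof.
apply/eqP; rewrite eqEsubv !cyc_subE // memvN mem_cyc /=.
by rewrite -memvN mem_cyc.
Qed.

(** The elementary operation on pairs of generators from which all the changes
    of generators below are composed. *)
Lemma cyc2_congr x y z b : x = (y + z)%R -> z \in cyc b ->
  (cyc x + cyc b = cyc y + cyc b)%VS.
Proof.
move=> -> zb; have zb' w : z \in (cyc w + cyc b)%VS.
  by apply: (subvP (addvSr _ _)).
apply/eqP; rewrite eqEsubv !cyc2_subE // !mem_cyc2r !andbT.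
rewrite memvD ?mem_cyc2l //=.
by rewrite -[X in X \in _](addrK z) memvB ?mem_cyc2l.
Qed.

Lemma mem_cyc_pow2 m n f v : m <= n -> v \in cyc f -> (T ^^ n) v \in cyc ((T ^^ m) f).
Proof.
move=> le_mn vf; rewrite -(subnK le_mn) powD inv_pow // -cyc_img.
exact: memv_img.
Qed.

Lemma cyc_pow_congr n f h : cyc h = cyc f -> cyc ((T ^^ n) h) = cyc ((T ^^ n) f).
Proof. by move=> hf; rewrite -!cyc_img hf. Qed.

Lemma fullv_not_cyc f : \dim (lker T) = 2 -> fullv <> cyc f.
Proof. by move=> k2 ef; have := dim_cyc_ker f; rewrite -ef capfv k2. Qed.

(** The vector [g] generates the short block of the Jordan form.  A complement
    [h] of a generator [g1] of a block of length [p] is corrected by an element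
    of that block: the first iterate of [h] that falls into [cyc g1] is
    divisible there by the same power of [T], because [g1] has the largest
    possible order. *)
Lemma jordan_gen : T ^^ p.-1 <> 0%R -> 0 < p -> \dim (lker T) = 2 ->
  exists q g, [/\ g \notin limg T, (T ^^ q) g = 0%R & \dim {:V} = p + q].
Proof.
move=> /eqP Tp1 p_gt0 k2.
have [g1 g1n] : exists g1, (T ^^ p.-1) g1 != 0%R.
  by have /lfunPn [g1] := Tp1; rewrite zero_lfunE => ?; exists g1.
have g1NT : g1 \notin limg T.
  apply: contraNN g1n => /memv_imgP [w _ ->].
  by rewrite -powSr prednK // powp.
have [h hV] := complement_gen k2 g1NT.
have ex0 : exists q, (T ^^ q) h \in cyc g1 by exists p; rewrite powp mem0v.
case: (ex_minnP ex0) => q hq min_q.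
have le_qp : q <= p by apply: min_q; rewrite powp mem0v.
have [e [g' [g'g1 def_y]]] := cyc_unit hq.
have le_qe : q <= e.
  (* Otherwise [T ^^ (p - q)] sends [T ^^ q h], which equals [T ^^ e g'], to
     zero although [p - q + e < p]. *)
  have g'n : (T ^^ p.-1) g' != 0%R.
    apply: contraNneq g1n => g'0; rewrite -memv0 -cyc0 -g'0.
    by rewrite (cyc_pow_congr _ g'g1) mem_cyc.
  rewrite leqNgt; apply: contraNN g'n => lt_eq; apply/eqP.
  apply: (@pow_eq0_leq _ _ _ (p - q + e)); first by lia.
  by rewrite powD -def_y -powD subnK // powp.
pose g := (h - (T ^^ (e - q)) g')%R.
have cg : (T ^^ (e - q)) g' \in cyc g1 by rewrite -g'g1 mem_cyc_pow.
have gq : (T ^^ q) g = 0%R by rewrite linearB /= -powD subnKC // def_y subrr.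
have gV : fullv = (cyc g + cyc g1)%VS.
  by rewrite -(@cyc2_congr h g ((T ^^ (e - q)) g')) // /g subrK.
have gmin k : (T ^^ k) g \in cyc g1 -> q <= k.
  move=> gk; apply: min_q; rewrite -[h](subrK ((T ^^ (e - q)) g')) -/g linearD.
  by rewrite memvD //= inv_pow.
exists q, g; split=> //.
  apply/negP => gT; apply: (@fullv_not_cyc g1) => //.
  apply/esym/eqP; rewrite eqEsubv subvf /=; apply: nakayama => //.
  by rewrite {1}gV addvC addvS // cyc_subE //; exact: limgS (subvf _).
rewrite gV dimv_disjoint_sum.
  rewrite addnC; congr (_ + _); apply: dim_cyc => //.
  - exact: powp.
  - move=> k lt_kp; apply: contraNneq g1n => g1k; apply/eqP.
    by apply: (pow_eq0_leq _ g1k); lia.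
  - move=> k; rewrite ltnNge; apply: contraNneq => gk; apply: gmin.
    by rewrite gk mem0v.
have iC : inv (cyc g :&: cyc g1)%VS by exact: inv_cap.
have [i def_i] := cyc_submod iC (capvSl _ _).
have : (T ^^ i) g \in (cyc g :&: cyc g1)%VS by rewrite def_i mem_cyc.
rewrite memv_cap => /andP [_ /gmin le_qi].
by rewrite def_i (pow_eq0_leq le_qi gq) cyc0.
Qed.

(** The stacked basis theorem for a submodule [W] of a module on two
    generators: [j] is the largest power of [T] dividing all of [W], attained
    at [f2], and what remains of [W] is seen in the other cyclic summand. *)
Lemma stacked_gen W : inv W -> W != 0%VS -> \dim (lker T) = 2 ->
  exists f1 f2 k j, fullv = (cyc f1 + cyc f2)%VS /\
    W = (cyc ((T ^^ (k + j)) f1) + cyc ((T ^^ j) f2))%VS.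
Proof.
move=> iW W0 k2.
have ex0 : exists j, (W <= T ^^ j @: fullv)%VS.
  by exists 0; rewrite /lfun_pow /= lim1g subvf.
have bd j : (W <= T ^^ j @: fullv)%VS -> j <= p.
  move=> sub; rewrite leqNgt; apply: contraNN W0 => /ltnW le_pj.
  rewrite -subv0; apply: (subv_trans sub); apply/subvP => _ /memv_imgP [w _ ->].
  by rewrite pow_ge // mem0v.
case: (ex_maxnP ex0 bd) => j Wj max_j.
have /subvPn [u uW uN] : ~~ (W <= T ^^ j.+1 @: fullv)%VS.
  by apply/negP => /max_j; rewrite ltnn.
have /memv_imgP [f2 _ def_u] := subvP Wj u uW.
have f2N : f2 \notin limg T.
  apply: contraNN uN => /memv_imgP [w _ f2w].
  by rewrite def_u f2w -powSr memv_img // memvf.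
have [f1 f12] := complement_gen k2 f2N.
have iC : inv (W :&: cyc ((T ^^ j) f1))%VS by exact: inv_cap.
have [k def_k] := cyc_submod iC (capvSr _ _).
exists f1, f2, k, j; split=> //; apply/eqP; rewrite eqEsubv cyc2_subE // -def_u uW andbT.
apply/andP; split; last first.
  by apply: (subvP (capvSl W (cyc ((T ^^ j) f1)))); rewrite def_k powD mem_cyc.
apply/subvP => v vW; have /memv_imgP [w _ def_v] := subvP Wj v vW.
have : w \in (cyc f1 + cyc f2)%VS by rewrite -f12 memvf.
case/memv_addP => w1 w1f [w2 w2f def_w].
have Tw2 : (T ^^ j) w2 \in cyc u by rewrite def_u mem_cyc_pow2.
have Tw1 : (T ^^ j) w1 = (v - (T ^^ j) w2)%R by rewrite def_v def_w linearD addrK.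
rewrite def_v def_w linearD memv_add //= powD -def_k memv_cap mem_cyc_pow2 //.
by rewrite andbT Tw1 memvB //; apply: subvP Tw2; rewrite cyc_subE.
Qed.

(** The iterates below [n] account for [cyc x] modulo [W], which bounds
    the codimension of [W] in [dim_quot]. *)
Lemma cyc_quot W x n : inv W -> (T ^^ n) x \in W ->
  (cyc x <= krylov T n x + W)%VS.
Proof.
move=> iW xn; apply: krylov_subP => k _; case: (ltnP k n) => [lt_kn|le_nk].
  by apply: (subvP (addvSl _ _)); exact: mem_krylov.
by apply: (subvP (addvSr _ _)); exact: inv_leq xn.
Qed.

Lemma dim_quot W x y m n : inv W -> fullv = (cyc x + cyc y)%VS ->
  (T ^^ m) x \in W -> (T ^^ n) y \in W -> \dim {:V} <= m + n + \dim W.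
Proof.
move=> iW Vxy xm yn.
have sub : (fullv <= krylov T m x + (krylov T n y + W))%VS.
  rewrite Vxy subv_add (subv_trans (cyc_quot iW yn)) ?addvSr // andbT.
  by rewrite (subv_trans (cyc_quot iW xm)) // addvS ?addvSr.
have := dimvS sub.
have [+ _] := dimv_add_leqif (krylov T m x) (krylov T n y + W).
have [+ _] := dimv_add_leqif (krylov T n y) W.
by have := dim_krylov T m x; have := dim_krylov T n y; lia.
Qed.

End Nilpotent.

(** * Normal forms *)

Section Tripod.
Variables (K : fieldType) (t : triple K) (p : nat).
Local Notation V := (tspace t).
Local Notation T := (toper t).
Local Notation U := (tsub t).
Local Notation cyc := (krylov T p).

(** The form of an indecomposable triple: [f] and [g] generate the two blocks of
    [T], of lengths [p] and [q], and [U] is adapted not to [g] but to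
    [g + T ^^ e f].  The inequalities on the parameters that make the triple
    indecomposable are kept as separate hypotheses. *)
Definition tripod q i j e : Prop :=
  T ^^ p = 0%R /\ exists f g : V,
    [/\ (T ^^ q) g = 0%R, \dim {:V} = p + q, fullv = (cyc f + cyc g)%VS
      & U = (cyc ((T ^^ i) f) + cyc ((T ^^ j) (g + (T ^^ e) f)%R))%VS].

Hypothesis Tp0 : T ^^ p = 0%R.
Let inv_cyc := @cyc_inv _ _ _ _ Tp0.
Let inv_cyc_cyc := @inv_cyc2 _ _ _ _ Tp0.
Hint Resolve inv_cyc inv_cyc_cyc : core.

Lemma cyc2_direct q a b : (T ^^ q) a = 0%R -> \dim {:V} = p + q ->
  fullv = (cyc a + cyc b)%VS -> (cyc a :&: cyc b = 0)%VS.
Proof.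
move=> aq dV Vab; apply/eqP; rewrite -dimv_eq0.
have := dimv_sum_cap (cyc a) (cyc b); rewrite -Vab dV.
rewrite -{2}(krylov_short aq (powp Tp0 a)).
by have := dim_krylov T q a; have := dim_krylov T p b; lia.
Qed.

(** The orders of [a] and [b] add up to at most [dim V], so the two cyclic
    submodules that they generate are independent. *)
Lemma adapted_decomposable q m n a b : \dim (lker T) = 2 ->
  (T ^^ q) a = 0%R -> \dim {:V} = p + q -> fullv = (cyc a + cyc b)%VS ->
  U = (cyc ((T ^^ m) a) + cyc ((T ^^ n) b))%VS -> ~ indecomposable t.
Proof.
move=> k2 aq dV Vab Uab; have cap0 := cyc2_direct aq dV Vab.
have subU : U = (U :&: cyc a + U :&: cyc b)%VS.
  apply/eqP; rewrite eqEsubv subv_add !capvSl !andbT {1}Uab.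
  have iU := tsub_invariant t.
  apply: addvS; rewrite subv_cap !cyc_subE // mem_cyc_pow // andbT Uab.
    exact: mem_cyc2l.
  exact: mem_cyc2r.
move/(_ (cyc a) (cyc b)); case=> //.
- by apply/directv_addP.
- apply/directv_addP/eqP; rewrite -subv0 -cap0.
  by apply: capvS; exact: capvSr.
- by move=> a0; apply: (fullv_not_cyc Tp0 (f := b)) => //; rewrite Vab a0 add0v.
- by move=> b0; apply: (fullv_not_cyc Tp0 (f := a)) => //; rewrite Vab b0 addv0.
Qed.

(** Let [f1], [f2] be adapted to [U], and let [g = y1 + y2] generate the short
    block of [V], with [y1] and [y2] in the two cyclic submodules.  If [y2] does
    not generate [cyc f2], then [f1] can be exchanged for [g].  If it does,
    write [y1] as [T ^^ e] of a generator of [cyc f1], up to sign: for [e = 0]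
    the vector [g] replaces [f1], for large [e] it replaces [f2] or leaves it
    unchanged, and in each of these cases the triple splits.  What is left is a
    tripod, where [i < q + e] holds since [U] would be cyclic otherwise. *)
Lemma tripod_of_indecomposable : T ^^ p.-1 <> 0%R -> 0 < p ->
    indecomposable t -> nker T U = 2 -> nker T fullv = 2 ->
  exists q i j e, [/\ j + e < i, i < q + e, q + e < p & 0 < e] /\ tripod q i j e.
Proof.
move=> Tp1 p_gt0 indec nU; rewrite /nker capfv => k2.
have [q [g [gNT gq dV]]] := jordan_gen Tp0 Tp1 p_gt0 k2.
have iU := tsub_invariant t.
have U0 : U != 0%VS by apply: contra_eqN nU => /eqP ->; rewrite /nker cap0v dimv0.
have [f1 [f2 [k [j [V12 U12]]]]] := stacked_gen Tp0 iU U0 k2.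
have : g \in (cyc f1 + cyc f2)%VS by rewrite -V12 memvf.
case/memv_addP => y1 y1f [y2 y2f def_g].
have [/memv_imgP [z zf def_y2]|y2NT] := boolP (y2 \in (T @: cyc f2)%VS).
  have cy1 : cyc y1 = cyc f1.
    apply: cyc_gen => //; apply: contraNN gNT => /memv_imgP [w _ def_y1].
    by rewrite def_g def_y1 def_y2 -linearD memv_img // memvf.
  (* [y1] generates [cyc f1], and [g] replaces [f1]. *)
  case: (@adapted_decomposable q (k + j) j g f2) => //.
    by rewrite (cyc2_congr Tp0 def_g y2f) cy1.
  rewrite U12 -(cyc_pow_congr Tp0 _ cy1); apply/esym.
  apply: (@cyc2_congr _ _ _ _ Tp0 _ _ ((T ^^ (k + j)) y2)).
    by rewrite -linearD -def_g.
  by apply: mem_cyc_pow2; rewrite ?leq_addl.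
have cy2 : cyc y2 = cyc f2 by exact: cyc_gen.
have [e [h [hf1 def_y1]]] : exists e h,
    cyc h = cyc f1 /\ (- y1)%R = (T ^^ e) h.
  by apply: cyc_unit; rewrite // memvN.
have {def_y1}def_y2 : y2 = (g + (T ^^ e) h)%R.
  by rewrite -def_y1 def_g addrC addrA addNr add0r.
have {}V12 : fullv = (cyc h + cyc y2)%VS by rewrite V12 hf1 cy2.
have {}U12 : U = (cyc ((T ^^ (k + j)) h) + cyc ((T ^^ j) y2))%VS.
  by rewrite U12 (cyc_pow_congr Tp0 _ hf1) (cyc_pow_congr Tp0 _ cy2).
have {}V12' : fullv = (cyc g + cyc h)%VS.
  by rewrite -(cyc2_congr Tp0 def_y2) ?mem_cyc_pow // addvC.
have [le_ke|lt_ek] := leqP k e.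
  (* [T ^^ (j + e) h] already lies in [U], and [g] replaces [y2]. *)
  case: (@adapted_decomposable q j (k + j) g h) => //.
  rewrite U12 addvC; apply: (@cyc2_congr _ _ _ _ Tp0 _ _ ((T ^^ (j + e)) h)).
    by rewrite def_y2 linearD powD.
  by apply: mem_cyc_pow2; rewrite ?mem_cyc //; lia.
have [le_pq|lt_qp] := leqP p (q + e).
  (* [T ^^ q] kills [y2] as well, so that [y2] generates the short block. *)
  case: (@adapted_decomposable q j (k + j) y2 h) => //; try by rewrite addvC.
  by rewrite def_y2 linearD /= gq add0r -powD (pow_ge Tp0).
have [e0|e_gt0] := posnP e.
  move: def_y2; rewrite e0 pow0E => def_y2.
  have def_g' : g = (- h + y2)%R by rewrite def_y2 addrC addrK.
  (* [g] is [- h] up to [cyc y2], and replaces [h]. *)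
  case: (@adapted_decomposable q (k + j) j g y2) => //.
    by rewrite (cyc2_congr Tp0 def_g') ?mem_cyc // cycN.
  rewrite U12 -[cyc ((T ^^ (k + j)) h)]cycN // -linearN; apply/esym.
  apply: (@cyc2_congr _ _ _ _ Tp0 _ _ ((T ^^ (k + j)) y2)).
    by rewrite -linearD -def_g'.
  by apply: mem_cyc_pow2; rewrite ?mem_cyc ?leq_addl.
exists q, (k + j), j, e; split; last first.
  by split=> //; exists h, g; split; rewrite -?def_y2 // addvC.
split=> //; first by lia.
rewrite ltnNge; apply/negP => le_qk.
(* Otherwise [U] is contained in a cyclic submodule: in that of [T ^^ j y2] if
   [j <= q], and in that of [h] if not, contradicting [n_U = 2]. *)
suff [z Uz] : exists z, (U <= cyc z)%VS.
  have := dimvS (capvS Uz (subvv (lker T))); have := dim_cyc_ker Tp0 z.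
  by move: nU; rewrite /nker; lia.
have Tqy : (T ^^ q) y2 = (T ^^ (q + e)) h by rewrite def_y2 linearD /= gq add0r powD.
have [le_jq|lt_qj] := leqP j q.
  exists ((T ^^ j) y2); rewrite U12 cyc2_subE // mem_cyc // andbT.
  by apply: (inv_leq (inv_cyc _) le_qk); rewrite -?Tqy ?mem_cyc_pow2 ?mem_cyc.
exists h; rewrite U12 cyc2_subE // mem_cyc_pow //=.
by apply: (inv_leq (inv_cyc _) (ltnW lt_qj)); rewrite ?Tqy ?mem_cyc_pow.
Qed.

End Tripod.

(** * Invariants of a tripod *)

Section TripodInvariants.
Variables (K : fieldType) (t : triple K) (p : nat).
Local Notation V := (tspace t).
Local Notation T := (toper t).
Local Notation U := (tsub t).
Local Notation cyc := (krylov T p).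
Variables (q i j e : nat).
Hypotheses (lt_ji : j + e < i) (lt_iq : i < q + e) (lt_qp : q + e < p) (e_gt0 : 0 < e).
Hypothesis nf : tripod t p q i j e.

Let Tp0 : T ^^ p = 0%R. Proof. by case: nf. Qed.
Let inv_cyc := @cyc_inv _ _ _ _ Tp0.
Let inv_cyc_cyc := @inv_cyc2 _ _ _ _ Tp0.
Hint Resolve inv_cyc inv_cyc_cyc : core.

Lemma tripod_gen : exists f g : V, [/\
    forall k, ((T ^^ k) f == 0%R) = (p <= k),
    forall k, ((T ^^ k) g == 0%R) = (q <= k),
    (cyc f :&: cyc g = 0)%VS,
    fullv = (cyc f + cyc g)%VS &
    U = (cyc ((T ^^ i) f) + cyc ((T ^^ j) (g + (T ^^ e) f)%R))%VS].
Proof.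
have [_ [f [g [gq dV Vfg Ufg]]]] := nf.
have Vgf : fullv = (cyc g + cyc f)%VS by rewrite addvC.
have cap0 : (cyc f :&: cyc g = 0)%VS by rewrite capvC (cyc2_direct Tp0 gq dV Vgf).
have dims : \dim (cyc f) + \dim (cyc g) = p + q.
  by rewrite -dV Vfg dimv_disjoint_sum.
have dg := dim_krylov T q g; have df := dim_krylov T p f.
rewrite (krylov_short gq (powp Tp0 g)) in dg.
exists f, g; split=> // k; apply/eqP/idP => [k0|le_k].
- by have := dim_krylov T k f; rewrite (krylov_short k0 (powp Tp0 f)); lia.
- exact: (pow_ge Tp0).
- by have := dim_krylov T k g; rewrite (krylov_short k0 (powp Tp0 g)); lia.
- exact: pow_eq0_leq gq.
Qed.

Lemma tripod_pow_eq0 n : (T ^^ n @: fullv == 0)%VS = (p <= n).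
Proof.
have [f [g [fk _ _ _ _]]] := tripod_gen.
apply/idP/idP => [/eqP n0|le_pn].
  by rewrite -fk -memv0 -n0 memv_img ?memvf.
rewrite -subv0; apply/subvP => _ /memv_imgP [v _ ->].
by rewrite (pow_ge Tp0) ?mem0v.
Qed.

Lemma tripod_order : nilpotency_order T p.
Proof.
split=> //; first by lia.
move=> p0; have := tripod_pow_eq0 p.-1; rewrite p0 lim0g eqxx => /esym; lia.
Qed.

Lemma tripod_dim : \dim {:V} = p + q.
Proof. by case: nf => _ [f [g []]]. Qed.

(** The lower bound on [dim U] counts generators of [V / U] through [f] and
    [h = g + T ^^ e f]; the upper bound uses that [T ^^ q h = T ^^ (q + e) f] is
    a multiple of [T ^^ i f]. *)
Lemma tripod_dim_sub : \dim U + (i + j) = p + q.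
Proof.
have [f [g [fk gk _ Vfg Ufg]]] := tripod_gen.
set h := (g + _)%R in Ufg.
have Vhf : fullv = (cyc h + cyc f)%VS.
  by rewrite (@cyc2_congr _ _ _ _ Tp0 h g ((T ^^ e) f)) ?mem_cyc_pow // addvC.
apply/eqP; rewrite eqn_leq; apply/andP; split; last first.
  rewrite -tripod_dim -[_ + (i + j)]addnC; apply: (dim_quot (x := f) (y := h)).
  - exact: tsub_invariant.
  - exact: etrans Vhf (addvC _ _).
  - by rewrite Ufg mem_cyc2l.
  - by rewrite Ufg mem_cyc2r.
have sub : (U <= krylov T (p - i) ((T ^^ i) f)
               + krylov T (q - j) ((T ^^ j) h))%VS.
  have -> : krylov T (p - i) ((T ^^ i) f) = cyc ((T ^^ i) f).
    by apply: krylov_short; rewrite ?(powp Tp0) // -powD; apply/eqP; rewrite fk; lia.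
  rewrite Ufg subv_add addvSl /=; apply: krylov_subP => k _.
  case: (ltnP k (q - j)) => [lt_k|le_k].
    by apply: (subvP (addvSr _ _)); exact: mem_krylov.
  apply: (subvP (addvSl _ _)); rewrite -powD linearD /=.
  have -> : (T ^^ (k + j)) g = 0%R by apply/eqP; rewrite gk; lia.
  by rewrite add0r -powD; apply: mem_cyc_pow2; rewrite ?mem_cyc //; lia.
have := dimvS sub.
have := dimv_add_leqif (krylov T (p - i) ((T ^^ i) f))
                       (krylov T (q - j) ((T ^^ j) h)).
move=> [+ _]; have := dim_krylov T (p - i) ((T ^^ i) f).
have := dim_krylov T (q - j) ((T ^^ j) h); lia.
Qed.

(** If [T ^^ n f] were in [U] for some [n < i], then [dim_quot] would bound the
    codimension of [U] by [n + j], which is less than [i + j]. *)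
Lemma tripod_pow_sub n : (T ^^ n @: fullv <= U)%VS = (i <= n).
Proof.
have [f [g [fk gk _ Vfg Ufg]]] := tripod_gen.
have iU := tsub_invariant t.
set h := (g + _)%R in Ufg.
have fU : (T ^^ i) f \in U by rewrite Ufg mem_cyc2l.
have hU : (T ^^ j) h \in U by rewrite Ufg mem_cyc2r.
have Vfh : fullv = (cyc f + cyc h)%VS.
  rewrite addvC (@cyc2_congr _ _ _ _ Tp0 h g ((T ^^ e) f)) ?mem_cyc_pow //.
  by rewrite addvC.
apply/idP/idP => [sub|le_in].
  rewrite leqNgt; apply/negP => lt_ni.
  have fnU : (T ^^ n) f \in U by apply: (subvP sub); rewrite memv_img ?memvf.
  have := dim_quot iU Vfh fnU hU; rewrite tripod_dim.
  by have := tripod_dim_sub; lia.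
rewrite Vfh limgD !cyc_img // subv_add !cyc_subE //.
rewrite (inv_leq iU le_in fU) (inv_leq iU _ hU) //; lia.
Qed.

(** The order of [T] on [U] is attained on [T ^^ j (g + T ^^ e f)], through its
    component on [f]. *)
Lemma tripod_sub_pow_eq0 n : (T ^^ n @: U == 0)%VS = (p - e - j <= n).
Proof.
have [f [g [fk gk cap0 _ Ufg]]] := tripod_gen.
rewrite Ufg limgD !cyc_img // addv_eq0 -!subv0 !cyc_subE //; last 2 first.
- by rewrite /invariant_subspace limg0 sub0v.
- by rewrite /invariant_subspace limg0 sub0v.
rewrite !memv0 -!powD fk linearD /= -powD.
apply/andP/idP => [[_ /eqP h0]|le_n].
  have : (T ^^ (n + j)) g \in (cyc f :&: cyc g)%VS.
    by rewrite memv_cap mem_cyc_pow // andbT -memvN (addr0_eq h0) mem_cyc_pow.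
  rewrite cap0 memv0 => /eqP g0; rewrite g0 add0r in h0.
  by move/eqP: h0; rewrite fk; lia.
split; first lia.
have /eqP -> : (T ^^ (n + j)) g == 0%R by rewrite gk; lia.
by rewrite add0r fk; lia.
Qed.

Lemma tripod_ker : \dim (lker T) = 2 /\ nker T U = 2.
Proof.
have [f [g [fk gk cap0 Vfg Ufg]]] := tripod_gen.
have iU := tsub_invariant t.
have fU : (T ^^ i) f \in U by rewrite Ufg mem_cyc2l.
have hU : (T ^^ j) (g + (T ^^ e) f)%R \in U by rewrite Ufg mem_cyc2r.
have le2 : \dim (lker T) <= 2.
  have Ef := dim_img T (cyc f); have Eg := dim_img T (cyc g).
  have := dim_img T fullv; rewrite capfv Vfg limgD.
  rewrite dimv_disjoint_sum // dimv_disjoint_sum; last first.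
    apply/eqP; rewrite -subv0 -cap0 capvS // cyc_imgT // cyc_subE //.
      by apply: inv_mem; rewrite ?mem_cyc.
    by apply: inv_mem; rewrite ?mem_cyc.
  by have := dim_cyc_ker Tp0 f; have := dim_cyc_ker Tp0 g; lia.
have fpU : (T ^^ p.-1) f \in (U :&: lker T)%VS.
  rewrite memv_cap memv_ker -powSE fk; apply/andP; split; last lia.
  by apply: (inv_leq iU _ fU); lia.
have gqU : (T ^^ q.-1) g \in (U :&: lker T)%VS.
  rewrite memv_cap memv_ker -powSE gk; apply/andP; split; last lia.
  have -> : (T ^^ q.-1) g = ((T ^^ q.-1) (g + (T ^^ e) f) - (T ^^ (q.-1 + e)) f)%R.
    by rewrite linearD /= -powD addrK.
  by rewrite memvB //; [apply: (inv_leq iU _ hU) | apply: (inv_leq iU _ fU)]; lia.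
have : 2 <= nker T U.
  rewrite /nker.
  have -> : 2 = \dim (<[(T ^^ p.-1) f]> + <[(T ^^ q.-1) g]>).
    rewrite dim_add_line ?dim_vline ?gk; first by case: leqP; lia.
    apply/negP => fg; have : (T ^^ p.-1) f \in (cyc f :&: cyc g)%VS.
      rewrite memv_cap mem_cyc_pow //=; apply: subvP fg.
      by rewrite -memvE mem_cyc_pow.
    by rewrite cap0 memv0 fk; lia.
  by apply: dimvS; rewrite subv_add -!memvE fpU.
by have := dimvS (capvSr U (lker T)); rewrite /nker; lia.
Qed.

End TripodInvariants.

(** * Indecomposability and uniqueness of the parameters *)

(** The submodules of a cyclic module form a chain, so the position of one of
    them is described by two lengths. *)
Lemma chain_lengths (K : fieldType) (V : vectType K) (T : 'End(V)) p (W U : {vspace V}) :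
    T ^^ p = 0%R -> invariant_subspace T W -> \dim (W :&: lker T) <= 1 ->
    invariant_subspace T U -> (U <= W)%VS ->
  exists r i, [/\ i <= r, \dim W = r, \dim U = r - i,
    forall n, (T ^^ n @: W <= U)%VS = (i <= n)
    & forall n, (T ^^ n @: U == 0)%VS = (r - i <= n)
    /\ (T ^^ n @: W == 0)%VS = (r <= n)].
Proof.
move=> Tp0 iW k1 iU UW; have [a Wa] := cyc_of_ker1 Tp0 iW k1.
have ex0 : exists r, (T ^^ r) a == 0%R by exists p; rewrite powp.
case: (ex_minnP ex0) => r /eqP ar min_r.
have dimk k : \dim (krylov T p ((T ^^ k) a)) = r - k.
  apply: dim_cyc => // [|l lt_l]; rewrite -powD.
    by apply: pow_eq0_leq ar; lia.
  by apply/negP => /min_r; lia.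
have [i0 Ui0] : exists i, U = krylov T p ((T ^^ i) a).
  by apply: cyc_submod; rewrite // -Wa.
have [i le_ir {i0}Ui0] : exists2 i, i <= r & U = krylov T p ((T ^^ i) a).
  case: (leqP i0 r) => [|/ltnW le_ri]; first by exists i0.
  by exists r; rewrite // Ui0 ar (pow_eq0_leq le_ri ar).
have dimW n : \dim (T ^^ n @: W) = r - n by rewrite Wa cyc_img // dimk.
exists r, i; split=> // [||n|n].
- by have := dimW 0; rewrite lim1g subn0.
- by rewrite Ui0 dimk.
- apply/idP/idP => [/dimvS|le_in]; first by rewrite dimW Ui0 dimk; lia.
  rewrite Wa cyc_img // cyc_subE //.
  by apply: (inv_leq iU le_in); rewrite Ui0 mem_cyc.
- by rewrite -!dimv_eq0 dimW Ui0 cyc_img // -powD dimk; split; lia.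
Qed.

(** Each summand of a decomposition has a one-dimensional kernel, so it is a
    chain, described with its part of [U] by lengths [r] and [s].  The order of
    [T] on [V], on [U] and on [V / U] is the maximum of the orders on the two
    summands, while dimensions add; no two pairs [(r, s)] give the values found
    for a tripod. *)
Lemma tripod_indecomposable (K : fieldType) (t : triple K) p q i j e :
  j + e < i -> i < q + e -> q + e < p -> 0 < e ->
  tripod t p q i j e -> indecomposable t.
Proof.
move=> lt_ji lt_iq lt_qp e_gt0 nf V1 V2 i1 i2 /directv_addP cap0 V12 dU U12.
have [Tp0 _] := nf.
have [k2 _] := tripod_ker lt_ji lt_iq lt_qp e_gt0 nf.
have iU := tsub_invariant t.
set T := toper t in i1 i2 k2 Tp0 iU *; set U := tsub t in iU dU U12 *.
have [->|V1n] := eqVneq V1 0%VS; [by left | right].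
apply/eqP; apply: contraTT isT => V2n.
have k1 : 0 < \dim (V1 :&: lker T).
  by rewrite lt0n dimv_eq0; apply: contraNneq V1n => /(inv_ker_eq0 Tp0 i1) ->.
have k2' : 0 < \dim (V2 :&: lker T).
  by rewrite lt0n dimv_eq0; apply: contraNneq V2n => /(inv_ker_eq0 Tp0 i2) ->.
have k12 : \dim (V1 :&: lker T) + \dim (V2 :&: lker T) <= 2.
  rewrite -k2 -dimv_disjoint_sum; first by rewrite dimvS // subv_add !capvSr.
  by apply/eqP; rewrite -subv0 -cap0 capvS ?capvSl.
have [k1' k2''] : \dim (V1 :&: lker T) <= 1 /\ \dim (V2 :&: lker T) <= 1 by lia.
have [r1 [s1 [le1 dV1 dU1 sub1 eq1]]] :=
  chain_lengths Tp0 i1 k1' (inv_cap iU i1) (capvSr _ _).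
have [r2 [s2 [le2 dV2 dU2 sub2 eq2]]] :=
  chain_lengths Tp0 i2 k2'' (inv_cap iU i2) (capvSr _ _).
have imgS n W : invariant_subspace T W -> (T ^^ n @: W <= W)%VS.
  by move=> iW; apply/subvP => _ /memv_imgP [v vW ->]; exact: inv_pow.
have dV : r1 + r2 = p + q.
  by rewrite -(tripod_dim nf) V12 dimv_disjoint_sum ?dV1 ?dV2.
have dU' : (r1 - s1) + (r2 - s2) + (i + j) = p + q.
  rewrite -(tripod_dim_sub lt_ji lt_iq lt_qp e_gt0 nf) -/U U12.
  by rewrite dimv_disjoint_sum ?dU1 ?dU2 //; apply/directv_addP.
have hp n : (p <= n) = (r1 <= n) && (r2 <= n).
  rewrite -(tripod_pow_eq0 lt_ji lt_iq lt_qp e_gt0 nf) V12 limgD addv_eq0.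
  by rewrite (eq1 n).2 (eq2 n).2.
have hk n : (p - e - j <= n) = (r1 - s1 <= n) && (r2 - s2 <= n).
  rewrite -(tripod_sub_pow_eq0 lt_ji lt_iq lt_qp e_gt0 nf) -/U U12 limgD addv_eq0.
  by rewrite (eq1 n).1 (eq2 n).1.
have hs n : (i <= n) = (s1 <= n) && (s2 <= n).
  rewrite -(tripod_pow_sub lt_ji lt_iq lt_qp e_gt0 nf) V12 limgD subv_add.
  by rewrite -sub1 -sub2 !subv_cap !imgS // !andbT.
have := hp p; have := hp (maxn r1 r2); have := hk (p - e - j).
have := hk (maxn (r1 - s1) (r2 - s2)); have := hs i; have := hs (maxn s1 s2).
lia.
Qed.

Lemma tripod_inj (K : fieldType) (t : triple K) p q i j e q' i' j' e' :
    [/\ j + e < i, i < q + e, q + e < p & 0 < e] ->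
    [/\ j' + e' < i', i' < q' + e', q' + e' < p & 0 < e'] ->
    tripod t p q i j e -> tripod t p q' i' j' e' ->
  [/\ q = q', i = i', j = j' & e = e'].
Proof.
move=> [a1 a2 a3 a4] [b1 b2 b3 b4] nf nf'.
have := tripod_dim nf; have := tripod_dim nf'.
have := tripod_dim_sub a1 a2 a3 a4 nf; have := tripod_dim_sub b1 b2 b3 b4 nf'.
have Hs n : (i <= n) = (i' <= n).
  by rewrite -(tripod_pow_sub a1 a2 a3 a4 nf) -(tripod_pow_sub b1 b2 b3 b4 nf').
have Hk n : (p - e - j <= n) = (p - e' - j' <= n).
  by rewrite -(tripod_sub_pow_eq0 a1 a2 a3 a4 nf) -(tripod_sub_pow_eq0 b1 b2 b3 b4 nf').
have := Hs i; have := Hs i'; have := Hk (p - e - j); have := Hk (p - e' - j').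
by move=> *; split; lia.
Qed.

(** * Similarity *)

Section Similarity.
Variable K : fieldType.
Implicit Types t : triple K.

Lemma similar_refl t : similar t t.
Proof.
exists \1%VF; split; rewrite ?lim1g ?comp_lfun1l ?comp_lfun1r //.
by exists id => v; rewrite id_lfunE.
Qed.

Lemma similar_trans t1 t2 t3 : similar t1 t2 -> similar t2 t3 -> similar t1 t3.
Proof.
move=> [f [bf fU fT]] [g [bg gU gT]]; exists (g \o f)%VF; split.
- have [f' fK f'K] := bf; have [g' gK g'K] := bg.
  by exists (f' \o g') => v; rewrite /= comp_lfunE /= ?gK ?fK // f'K g'K.
- by rewrite limg_comp fU.
- by rewrite -comp_lfunA fT comp_lfunA gT -comp_lfunA.
Qed.

Lemma bij_lfunK (V W : vectType K) (f : 'Hom(V, W)) : bijective f ->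
  cancel f f^-1%VF /\ cancel f^-1%VF f.
Proof.
move=> [g fK gK]; have fK' : cancel f f^-1%VF.
  by apply/lker0_lfunK/lker0P/(can_inj fK).
by split=> // w; rewrite -[w]gK fK'.
Qed.

Lemma similar_sym t1 t2 : similar t1 t2 -> similar t2 t1.
Proof.
move=> [f [bf fU fT]]; have [fK fVK] := bij_lfunK bf; exists f^-1%VF; split.
- by exists f.
- rewrite -fU -limg_comp -[RHS]lim1g; congr (_ @: _)%VS.
  by apply/lfunP => v; rewrite comp_lfunE id_lfunE fK.
- apply/lfunP => w; rewrite !comp_lfunE; apply: (can_inj fK).
  by have /lfunP /(_ (f^-1%VF w)) := fT; rewrite !comp_lfunE !fVK => ->.
Qed.

Lemma similar_eq t1 t2 : similar t1 t2 -> similar t1 = similar t2.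
Proof.
move=> t12; apply: funext => t; apply: propext; split.
  by apply: similar_trans; exact: similar_sym.
exact: similar_trans.
Qed.

Section Intertwiner.
Variables (V V' : vectType K) (T : 'End(V)) (T' : 'End(V')) (f : 'Hom(V, V')).
Hypothesis fT : (f \o T)%VF = (T' \o f)%VF.

Lemma intertwine_pow n v : f ((T ^^ n) v) = (T' ^^ n) (f v).
Proof.
elim: n => [|n IH]; first by rewrite !pow0E.
by rewrite !powSE -IH; have /lfunP /(_ ((T ^^ n) v)) := fT; rewrite !comp_lfunE.
Qed.

Lemma intertwine_krylov n v : (f @: krylov T n v)%VS = krylov T' n (f v).
Proof.
rewrite limg_span -map_comp; congr <<_>>%VS; apply: eq_map => k /=.
exact: intertwine_pow.
Qed.

End Intertwiner.

Lemma tripod_transfer t t' p q i j e :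
  similar t t' -> tripod t p q i j e -> tripod t' p q i j e.
Proof.
move=> [phi [bphi phiU phiT]] [Tp0 [f [g [gq dV Vfg Ufg]]]].
have [phiK phiVK] := bij_lfunK bphi.
have phiV : (phi @: fullv)%VS = fullv.
  apply/eqP; rewrite eqEsubv subvf; apply/subvP => w _.
  by rewrite -[w]phiVK memv_img ?memvf.
have phi_pow := intertwine_pow phiT; have phi_kry := intertwine_krylov phiT.
split.
  by apply/lfunP => w; rewrite -[w]phiVK -phi_pow Tp0 !zero_lfunE linear0.
exists (phi f), (phi g); split.
- by rewrite -phi_pow gq linear0.
- rewrite -phiV limg_dim_eq // capfv; apply/eqP/lker0P; exact: can_inj phiK.
- by rewrite -phiV Vfg limgD !phi_kry.
- by rewrite -phiU Ufg limgD !phi_kry !phi_pow linearD /= phi_pow.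
Qed.

(** The iterates of [f] and [g] form a basis of [V], and matching the bases of
    two triples with the same parameters respects all the structure. *)
Lemma similar_tripods t t' p q i j e :
  tripod t p q i j e -> tripod t' p q i j e -> similar t t'.
Proof.
pose B (u : triple K) f g :=
  mkseq (fun k => (toper u ^^ k) f) p ++ mkseq (fun k => (toper u ^^ k) g) q.
have spanB u f g : toper u ^^ p = 0%R -> (toper u ^^ q) g = 0%R ->
    fullv = (krylov (toper u) p f + krylov (toper u) p g)%VS ->
    <<B u f g>>%VS = fullv.
  move=> Tp0 gq ->; rewrite span_cat -/(krylov _ _ _) -/(krylov _ q g).
  by rewrite (krylov_short gq (powp Tp0 g)).
move=> [Tp0 [f [g [gq dV Vfg Ufg]]]] [Tp0' [f' [g' [gq' dV' Vfg' Ufg']]]].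
have sB := spanB _ _ _ Tp0 gq Vfg; have sB' := spanB _ _ _ Tp0' gq' Vfg'.
have [phi0 /= Hphi] := linear_of_free (B t f g) (B t' f' g').
pose phi : 'Hom(tspace t, tspace t') := linfun phi0.
have {Hphi} phiB : map phi (B t f g) = B t' f' g'.
  rewrite -[RHS]Hphi; first by apply: eq_map => v; rewrite lfunE.
    apply: (@basis_free _ _ fullv); rewrite basisEdim sB subvv /=.
    by rewrite size_cat !size_mkseq dV.
  by rewrite !size_cat !size_mkseq.
have [phif phig] : (forall k, k < p -> phi ((toper t ^^ k) f) = (toper t' ^^ k) f')
                /\ (forall k, k < q -> phi ((toper t ^^ k) g) = (toper t' ^^ k) g').
  move/eqP: phiB; rewrite map_cat eqseq_cat ?size_map //.
  case/andP => /eqP e1 /eqP e2; split=> k lt_k.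
    have := congr1 (fun s => nth 0%R s k) e1.
    by rewrite (nth_map 0%R) ?size_mkseq // !nth_mkseq.
  have := congr1 (fun s => nth 0%R s k) e2.
  by rewrite (nth_map 0%R) ?size_mkseq // !nth_mkseq.
have phif' k : phi ((toper t ^^ k) f) = (toper t' ^^ k) f'.
  case: (ltnP k p) => [/phif //|le_pk].
  by rewrite (pow_ge Tp0) // (pow_ge Tp0') // linear0.
have phig' k : phi ((toper t ^^ k) g) = (toper t' ^^ k) g'.
  case: (ltnP k q) => [/phig //|le_qk].
  by rewrite (pow_eq0_leq le_qk gq) (pow_eq0_leq le_qk gq') linear0.
have phiT : (phi \o toper t)%VF = (toper t' \o phi)%VF.
  apply/(fullv_lfunP _ _ sB) => v; rewrite mem_cat !comp_lfunE.
  by case/orP => /mapP [k _ ->]; rewrite -powSE ?phif' ?phig' powSE.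
have phi0f := phif' 0; have phi0g := phig' 0; rewrite !pow0E in phi0f phi0g.
have phiV : limg phi = fullv by rewrite -sB limg_span phiB sB'.
exists phi; split=> //.
  have ker0 : lker phi == 0%VS.
    rewrite -dimv_eq0; have := limg_ker_dim phi fullv.
    by rewrite capfv phiV dV dV'; lia.
  exists phi^-1%VF; first exact: lker0_lfunK.
  by move=> w; rewrite limg_lfunVK // phiV memvf.
rewrite Ufg Ufg' limgD !(intertwine_krylov phiT) !(intertwine_pow phiT).
by rewrite linearD /= (intertwine_pow phiT) phi0f phi0g.
Qed.

End Similarity.

(** * Models *)

(** The model lives on row vectors; [T] shifts the standard basis to the right,
    in the two blocks of coordinates before and from position [p]. *)
Section Model.
Variables (K : fieldType) (p q : nat).
Hypotheses (p_gt0 : 0 < p) (le_qp : q <= p).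

(** Zero for [k] beyond the last coordinate, so that the shift of the last basis
    vector needs no separate case. *)
Definition row_basis k : 'rV[K]_(p + q) := \row_l ((l : nat) == k)%:R%R.

Definition shift_mx : 'M[K]_(p + q) :=
  \matrix_(a, b) (((b : nat) == a.+1) && ((b : nat) != p))%:R%R.

Definition shift : 'End('rV[K]_(p + q)) := linfun (mulmxr shift_mx).

Lemma row_basis_big k : p + q <= k -> row_basis k = 0%R.
Proof.
by move=> le_k; apply/rowP => l; rewrite !mxE; have := ltn_ord l; case: eqP => //; lia.
Qed.

Lemma shiftE k : shift (row_basis k) = if k.+1 == p then 0%R else row_basis k.+1.
Proof.
have -> : shift (row_basis k) = \row_l (((l : nat) == k.+1) && ((l : nat) != p))%:R%R.
  rewrite lfunE /=; apply/rowP => l; rewrite !mxE.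
  have [lt_k|le_k] := ltnP k (p + q).
    rewrite (bigD1 (Ordinal lt_k)) //= big1 ?addr0 => [|a /negPf ak]; last first.
      by rewrite mxE -[(a : nat) == k]/(a == Ordinal lt_k) ak mul0r.
    by rewrite !mxE eqxx mul1r.
  rewrite big1 => [|a _]; first by have := ltn_ord l; case: eqP => //; lia.
  by rewrite row_basis_big // mxE mul0r.
case: (eqVneq k.+1 p) => [<-|kp]; apply/rowP => l; rewrite !mxE; first by rewrite andbN.
by have [->|] := eqVneq (l : nat) k.+1; rewrite ?kp.
Qed.

Lemma shift_pow_long k : k < p -> (shift ^^ k) (row_basis 0) = row_basis k.
Proof.
elim: k => [|k IH] lt_kp; first by rewrite pow0E.
by rewrite powSE IH ?shiftE; [case: eqP => //; lia | lia].
Qed.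

Lemma shift_pow_short k : (shift ^^ k) (row_basis p) = row_basis (p + k).
Proof.
elim: k => [|k IH]; first by rewrite pow0E addn0.
by rewrite powSE IH shiftE addnS; case: eqP => //; lia.
Qed.

Lemma row_basis_gen l : l < p + q ->
  exists2 v, v \in [:: row_basis 0; row_basis p] & exists k, row_basis l = (shift ^^ k) v.
Proof.
move=> lt_l; case: (ltnP l p) => [lt_lp|le_pl].
  by exists (row_basis 0); rewrite ?mem_head //; exists l; rewrite shift_pow_long.
exists (row_basis p); first by rewrite !inE eqxx orbT.
by exists (l - p); rewrite shift_pow_short subnKC.
Qed.

Lemma row_basis_sum (v : 'rV[K]_(p + q)) : v = (\sum_l v 0 l *: row_basis l)%R.
Proof.
apply/rowP => l; rewrite summxE (bigD1 l) //= big1 ?addr0 => [|m ml].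
  by rewrite !mxE eqxx mulr1.
by rewrite !mxE eq_sym -[(m : nat) == l]/(m == l) (negPf ml) mulr0.
Qed.

Lemma shift_pow_eq0 : shift ^^ p = 0%R.
Proof.
have f0 : (shift ^^ p) (row_basis 0) = 0%R.
  have := powSE shift p.-1 (row_basis 0); rewrite prednK // => ->.
  by rewrite shift_pow_long ?shiftE prednK ?eqxx.
have g0 : (shift ^^ p) (row_basis p) = 0%R.
  by rewrite shift_pow_short row_basis_big // leq_add2l.
apply/lfunP => v; rewrite zero_lfunE [v]row_basis_sum linear_sum big1 // => l _.
have [w ww [k ->]] := row_basis_gen (ltn_ord l).
rewrite linearZ /= powC; suff -> : (shift ^^ p) w = 0%R by rewrite linear0 scaler0.
by move: ww; rewrite !inE => /orP [] /eqP ->.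
Qed.

(** Stated as data, so that a representative can be picked for each value of the
    parameters. *)
Lemma tripod_model i j e : {t : triple K | tripod t p q i j e}.
Proof.
pose c := krylov shift p; pose f := row_basis 0; pose g := row_basis p.
pose U := (c ((shift ^^ i) f) + c ((shift ^^ j) (g + (shift ^^ e) f)%R))%VS.
have nil : exists n, shift ^^ n = 0%R by exists p; exact: shift_pow_eq0.
have iU : invariant_subspace shift U by exact: inv_cyc2 shift_pow_eq0 _ _.
exists (Triple nil iU); split=> /=; first exact: shift_pow_eq0.
exists f, g; split=> //=.
- by rewrite shift_pow_short row_basis_big.
- by rewrite dimvf /dim /= mul1n.
apply/esym/eqP; rewrite eqEsubv subvf /=; apply/subvP => v _.
rewrite [v]row_basis_sum; apply: memv_suml => l _; apply: memvZ.
have [w ww [k ->]] := row_basis_gen (ltn_ord l).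
have iV := inv_cyc2 shift_pow_eq0 f g; apply: inv_pow => //.
move: ww; rewrite !inE => /orP [] /eqP ->.
  exact: mem_cyc2l shift_pow_eq0 _ _.
exact: mem_cyc2r shift_pow_eq0 _ _.
Qed.

End Model.

(** * Counting *)

(** Finding the representative of a given class takes choice, since membership
    in a class is not decidable. *)
Lemma card_similarity_classes (K : fieldType) (P : triple K -> Prop)
    (I : finType) (m : I -> triple K) :
  (forall a, P (m a)) -> (forall a b, similar (m a) (m b) -> a = b) ->
  (forall t, P t -> exists a, similar (m a) t) ->
  number_similarity_classes P #|I|.
Proof.
move=> Pm inj surj.
pose F (x : 'I_#|I|) : similarity_classes P :=
  exist _ (similar (m (enum_val x))) (ex_intro2 _ _ (m (enum_val x)) (Pm _) erefl).
have F_inj x y : F x = F y -> x = y.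
  move=> /(congr1 sval) /= Fxy; apply/enum_val_inj/inj.
  by rewrite Fxy; exact: similar_refl.
have F_surj C : exists x, F x = C.
  case: C => C HC; have [t Pt Ct] := HC; have [a at_] := surj t Pt.
  exists (enum_rank a); apply: eq_exist => /=.
  by rewrite enum_rankK Ct; exact: similar_eq.
have [G FG] : exists G, cancel G F.
  by exists (fun C => sval (cid (F_surj C))) => C; case: cid.
by exists F, G => // x; apply: F_inj; rewrite FG.
Qed.

Lemma number_indecomposable_two_blocks (K : fieldType) (p : nat) : 0 < p ->
  number_similarity_classes
    (fun t : triple K =>
       [/\ indecomposable t, nilpotency_order (toper t) p,
           nker (toper t) (tsub t) = 2 & nker (toper t) fullv = 2])
    'C(p, 4).
Proof.
move=> p_gt0; pose sorted4 (s : 4.-tuple 'I_p) := sorted ltn (map val s).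
have -> : 'C(p, 4) = #|{: {s : 4.-tuple 'I_p | sorted4 s}}|.
  by rewrite -card_ltn_sorted_tuples card_sig; apply: eq_card => s; rewrite !inE.
pose c (s : {s | sorted4 s}) k : nat := nth 0 (map val (val s)) k.
have cP s : [/\ c s 0 < c s 1, c s 1 < c s 2, c s 2 < c s 3 & c s 3 < p].
  rewrite /c; case: s => -[[|a0 [|a1 [|a2 [|a3 [|? ?]]]]] // sz] /=.
  by rewrite /sorted4 /= andbT => /and3P [].
have c_inj s s' : (forall k, k < 4 -> c s k = c s' k) -> s = s'.
  move=> eq_c; apply/val_inj/val_inj/(inj_map val_inj).
  by apply: (@eq_from_nth _ 0) => [|k]; rewrite !size_map !size_tuple // => /eq_c.
have cE n0 n1 n2 n3 : n0 < n1 -> n1 < n2 -> n2 < n3 -> n3 < p ->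
    exists s, [/\ c s 0 = n0, c s 1 = n1, c s 2 = n2 & c s 3 = n3].
  move=> lt01 lt12 lt23 lt3p.
  have [lt0p lt1p lt2p] : [/\ n0 < p, n1 < p & n2 < p] by split; lia.
  have so : sorted4 [tuple Ordinal lt0p; Ordinal lt1p; Ordinal lt2p; Ordinal lt3p].
    by rewrite /sorted4 /= lt01 lt12 lt23.
  by exists (exist (fun s => sorted4 s) _ so).
(* The entries of [s] are [j < i - e < q < p - e]. *)
pose e s := p - c s 3; pose i s := c s 1 + e s.
have bounds s : [/\ c s 0 + e s < i s, i s < c s 2 + e s, c s 2 + e s < p & 0 < e s].
  by have [] := cP s; rewrite /i /e; split; lia.
have [m mP] : exists m : {s | sorted4 s} -> triple K,
    forall s, tripod (m s) p (c s 2) (i s) (c s 0) (e s).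
  have le_qp s : c s 2 <= p by have [] := bounds s; lia.
  exists (fun s => sval (tripod_model K p_gt0 (le_qp s) (i s) (c s 0) (e s))).
  by move=> s; case: tripod_model.
apply: (card_similarity_classes (m := m)).
- move=> s; have [b1 b2 b3 b4] := bounds s; split.
  + exact: tripod_indecomposable (mP s).
  + exact: tripod_order (mP s).
  + exact: (tripod_ker b1 b2 b3 b4 (mP s)).2.
  + by rewrite /nker capfv (tripod_ker b1 b2 b3 b4 (mP s)).1.
- move=> s s' /tripod_transfer - /(_ _ _ _ _ _ (mP s)) nf.
  have [] := tripod_inj (bounds s) (bounds s') nf (mP s').
  have [_ _ _ l] := cP s; have [_ _ _ l'] := cP s'.
  rewrite /i /e => e2 e1 e0 e3; apply: c_inj => -[|[|[|[|k]]]] //; lia.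
- move=> t [indec [_ Tp0 Tp1] nU nV].
  have [q [i0 [j0 [e0 [[b1 b2 b3 b4] nf]]]]] :=
    tripod_of_indecomposable Tp0 Tp1 p_gt0 indec nU nV.
  have [|||| s [s0 s1 s2 s3]] := cE j0 (i0 - e0) q (p - e0); try lia.
  exists s; apply: similar_tripods (mP s) _.
  have -> : e s = e0 by rewrite /e s3; lia.
  have -> : i s = i0 by rewrite /i /e s3 s1; lia.
  by rewrite s0 s2.
Qed.

Theorem theoremB (R : realType) (p : nat) (hp : (1 <= p)%N) :
  number_similarity_classes
    (fun t : triple (complex R) =>
       [/\ indecomposable t,
           nilpotency_order (toper t) p,
           nker (toper t) (tsub t) = 2%N
         & nker (toper t) fullv = 2%N])
    'C(p, 4).
Proof. exact: number_indecomposable_two_blocks. Qed.
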